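(* Let $\mathfrak{g}$ be a finite-dimensional complex Lie algebra and $\mathfrak{a}$ an abelian ideal of $\mathfrak{g}$. For $\ell\in\mathfrak{g}^*$ let $\ell_0=\ell_{|\mathfrak{a}}$, and let $\Omega$ be the set of $\ell\in\mathfrak{g}^*$ such that $\operatorname{codim}_{\mathfrak{a}^*}(\mathfrak{g}.\ell_0)=\operatorname{ind}(\mathfrak{g},\mathfrak{a})$. The following assertions are equivalent: (1) $\operatorname{ind}(\mathfrak{g})+\dim\mathfrak{a}=\dim(\mathfrak{g}/\mathfrak{a})+2\operatorname{ind}(\mathfrak{g},\mathfrak{a})$. (2) For every $\ell\in\Omega$, $\mathfrak{a}+\mathfrak{g}^\ell=\mathfrak{a}^\ell$. (3) For every $\ell\in\Omega$, $\mathfrak{a}+\mathfrak{g}^\ell$ is a polarization at $\ell$. (4) For every $\ell\in\Omega$, $\mathfrak{a}^\ell$ is a polarization at $\ell$.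
   Context: For $\ell\in\mathfrak{g}^*$ and a subspace $V\subset\mathfrak{g}$, $V^\ell=\{x\in\mathfrak{g}: \langle\ell,[x,v]\rangle=0 \text{ for all } v\in V\}$ is the orthogonal of $V$ relative to the alternating form $B_\ell(x,y)=\langle\ell,[x,y]\rangle$; $\mathfrak{g}^\ell$ is the kernel of $B_\ell$. A polarization at $\ell$ is a Lie subalgebra $\mathfrak{p}$ of $\mathfrak{g}$ such that $\mathfrak{p}^\ell=\mathfrak{p}$ (i.e. a subalgebra which is a maximal totally isotropic subspace for $B_\ell$). The index of $\mathfrak{g}$ is $\operatorname{ind}(\mathfrak{g})=\min_{\ell\in\mathfrak{g}^*}\dim\mathfrak{g}^\ell$. $\mathfrak{g}$ acts on $\mathfrak{a}^*$ by $\langle x.f,a\rangle=-\langle f,[x,a]\rangle$; for $f\in\mathfrak{a}^*$, $\mathfrak{g}.f=\{x.f:x\in\mathfrak{g}\}\subset\mathfrak{a}^*$, and $\operatorname{ind}(\mathfrak{g},\mathfrak{a})=\min_{f\in\mathfrak{a}^*}\operatorname{codim}_{\mathfrak{a}^*}(\mathfrak{g}.f)$. *)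

(* Defs.v *)
From HB Require Import structures.
From mathcomp Require Import all_boot all_order all_algebra.
From mathcomp Require Import boolp reals.
From mathcomp.real_closed Require Export complex.

Set Implicit Arguments.
Unset Strict Implicit.
Unset Printing Implicit Defensive.

Import GRing.Theory.
Local Open Scope ring_scope.

HB.mixin Record Vector_isLieAlgebra (K : fieldType) (V : Type)
  of Vector K V := {
  lie : V -> V -> V;
  lie_linearr : forall x : V, linear (lie x);
  lie_linearl : forall y : V, linear (lie^~ y);
  liexx : forall x : V, lie x x = 0;
  lie_jacobi : forall x y z : V,
    lie x (lie y z) + lie y (lie z x) + lie z (lie x y) = 0
}.

(* Finite-dimensional Lie algebras over K. *)
#[short(type="lieAlgebraType")]
HB.structure Definition LieAlgebra (K : fieldType) :=
  {V of Vector_isLieAlgebra K V & Vector K V}.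

Notation "[ 'lie' x , y ]" := (lie x y)
  (at level 0, x, y at level 99, format "[ 'lie'  x ,  y ]") : ring_scope.

Section LieAlgebraTheory.
Variables (K : fieldType) (g : lieAlgebraType K).
Implicit Types (x y : g) (V P A : {vspace g}) (l : 'Hom(g, K^o)).

Definition is_subalgebra P : Prop :=
  forall x y, x \in P -> y \in P -> [lie x, y] \in P.

Definition is_ideal A : Prop :=
  forall x a, a \in A -> [lie x, a] \in A.

Definition is_abelian A : Prop :=
  forall a b, a \in A -> b \in A -> [lie a, b] = 0.

HB.instance Definition _ x :=
  GRing.isLinear.Build K g g *:%R (lie x) (lie_linearr x).

Definition ad x : 'End(g) := linfun (lie x).

Lemma adE x y : ad x y = [lie x, y].
Proof. exact: lfunE. Qed.

Lemma ad_linear : linear ad.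
Proof.
move=> k x y; apply/lfunP => z.
by rewrite add_lfunE scale_lfunE !adE (lie_linearl z).
Qed.

Definition orth_map l V x : 'Hom(subvs_of V, K^o) :=
  (l \o (ad x \o linfun (@vsval _ _ V)))%VF.

Lemma orth_mapE l V x (v : subvs_of V) :
  orth_map l V x v = l [lie x, vsval v].
Proof. by rewrite !comp_lfunE adE lfunE. Qed.

Lemma orth_map_linear l V : linear (orth_map l V).
Proof.
move=> k x y; apply/lfunP => v.
by rewrite add_lfunE scale_lfunE !orth_mapE (lie_linearl (vsval v)) linearP.
Qed.

HB.instance Definition _ l V :=
  GRing.isLinear.Build K g 'Hom(subvs_of V, K^o) *:%R
    (orth_map l V) (orth_map_linear l V).

(* The orthogonal V^l; see orthP. *)
Definition orth l V : {vspace g} := lker (linfun (orth_map l V)).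

Lemma orthP l V x :
  reflect (forall v, v \in V -> l [lie x, v] = 0) (x \in orth l V).
Proof.
rewrite memv_ker lfunE /=; apply: (iffP eqP) => [+ v Vv | lx0].
  by move/lfunP/(_ (Subvs Vv)); rewrite orth_mapE zero_lfunE.
by apply/lfunP => v; rewrite orth_mapE zero_lfunE; apply/lx0/subvsP.
Qed.

Definition form_ker l : {vspace g} := orth l fullv.

Definition is_polarization l P : Prop := is_subalgebra P /\ orth l P = P.

End LieAlgebraTheory.

Section Minimum.
Variables (T : Type) (t0 : T) (F : T -> nat).

Lemma ex_value : exists n, `[< exists t, F t = n >].
Proof. by exists (F t0); apply/asboolP; exists t0. Qed.

(* The least value of F; it does not depend on t0, which only witnesses that T
   is inhabited. *)
Definition min_value : nat := ex_minn ex_value.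

Lemma min_valueP : (exists t, F t = min_value) /\ (forall t, min_value <= F t)%N.
Proof.
rewrite /min_value; case: ex_minnP => n /asboolP exn minn; split=> // t.
by apply: minn; apply/asboolP; exists t.
Qed.

End Minimum.

Section Index.
Variables (K : fieldType) (g : lieAlgebraType K).
Implicit Types (x y : g) (A : {vspace g}) (l : 'Hom(g, K^o)).

Definition ind : nat :=
  min_value (0 : 'Hom(g, K^o)) (fun l => \dim (form_ker l)).

Definition restr A l : 'Hom(subvs_of A, K^o) :=
  (l \o linfun (@vsval _ _ A))%VF.

Lemma restrE A l (a : subvs_of A) : restr A l a = l (vsval a).
Proof. by rewrite comp_lfunE lfunE. Qed.

(* x.f for f in A^*.  The projection vsproj A turns [x, a] into an element of
   the type subvs_of A; when A is an ideal it leaves [x, a] unchanged, see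
   coactE. *)
Definition coact A (f : 'Hom(subvs_of A, K^o)) x : 'Hom(subvs_of A, K^o) :=
  - (f \o (linfun (vsproj A) \o (ad x \o linfun (@vsval _ _ A))))%VF.

Lemma coact_vsproj A (f : 'Hom(subvs_of A, K^o)) x (a : subvs_of A) :
  coact f x a = - f (vsproj A [lie x, vsval a]).
Proof. by rewrite opp_lfunE !comp_lfunE adE !lfunE. Qed.

Lemma coactE A (f : 'Hom(subvs_of A, K^o)) x (a : subvs_of A)
    (xaA : [lie x, vsval a] \in A) :
  coact f x a = - f (Subvs xaA).
Proof.
by rewrite coact_vsproj; congr (- f _); apply/val_inj; rewrite /= vsprojK.
Qed.

Lemma coact_linear A (f : 'Hom(subvs_of A, K^o)) : linear (coact f).
Proof.
move=> k x y; apply/lfunP => a; rewrite add_lfunE scale_lfunE !coact_vsproj.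
by rewrite (lie_linearl (vsval a)) (linearP (vsproj A)) (linearP f) opprD scalerN.
Qed.

HB.instance Definition _ A (f : 'Hom(subvs_of A, K^o)) :=
  GRing.isLinear.Build K g 'Hom(subvs_of A, K^o) *:%R
    (coact f) (coact_linear f).

(* The subspace g.f of A^*. *)
Definition coorbit A (f : 'Hom(subvs_of A, K^o)) :
    {vspace 'Hom(subvs_of A, K^o)} :=
  limg (linfun (coact f)).

Lemma coorbitP A (f h : 'Hom(subvs_of A, K^o)) :
  reflect (exists x, h = coact f x) (h \in coorbit f).
Proof.
apply: (iffP memv_imgP) => [[x _ ->]|[x ->]]; exists x; rewrite ?memvf //.
  exact: lfunE.
by rewrite lfunE.
Qed.

(* The codimension of g.f in A^*. *)
Definition coorbit_codim A (f : 'Hom(subvs_of A, K^o)) : nat :=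
  (\dim {: 'Hom(subvs_of A, K^o)} - \dim (coorbit f))%N.

Definition rel_ind A : nat :=
  min_value (0 : 'Hom(subvs_of A, K^o)) (@coorbit_codim A).

Definition Omega A l : Prop := coorbit_codim (restr A l) = rel_ind A.

End Index.

Arguments ind {K} g.

(* Main.v *)
(* Since a is abelian, a + g^l is contained in a^l, and it is the orthogonal of
   a^l; moreover a^l, the stabilizer of l_0, is a subalgebra because a is an
   ideal. Hence (2), (3) and (4) all say that a + g^l = a^l for every l in Omega.
   A dimension count gives, for l in Omega,
     dim g^l + dim a <= dim (g/a) + 2 ind(g, a),
   with equality exactly when a + g^l = a^l. So (1) implies (2), as
   ind g <= dim g^l; conversely one needs some l in Omega with dim g^l = ind g.
   It is found on the line through a point of Omega and a point where dim g^l is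
   minimal: on a line the rank of a linear family of matrices is at least its
   value at a given point outside the roots of a nonzero polynomial. *)

From HB Require Import structures.
Require Import Defs.
From mathcomp Require Import all_boot all_order all_algebra.
From mathcomp Require Import reals.
From mathcomp Require Import zify.

Set Implicit Arguments.
Unset Strict Implicit.
Unset Printing Implicit Defensive.

Import GRing.Theory VectorInternalTheory.
Local Open Scope ring_scope.

(* In [A + t B], compress by one-sided inverses of the factors of [A] so that it
   becomes invertible at [t = 0]; [p] is the determinant of the result. The scope
   [%R] is needed since [\rank] would read [+] as a sum of row spaces. *)
Lemma mxrank_line (F : fieldType) (m n : nat) (A B : 'M[F]_(m, n)) :
  exists2 p : {poly F}, ~~ root p 0 &
    forall t, ~~ root p t -> (\rank A <= \rank (A + t *: B)%R)%N.
Proof.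
pose U := pinvmx (col_base A); pose V := pinvmx (row_base A).
pose M t := U *m (A + t *: B) *m V.
have M0 : M 0 = 1%:M.
  rewrite /M scale0r addr0 -[X in U *m X]mulmx_base mulmxA.
  by rewrite mulVpmx ?col_base_full // mul1mx mulmxVp ?row_base_free.
pose p := \det (map_mx polyC (U *m A *m V) + 'X *: map_mx polyC (U *m B *m V)).
have pE t : p.[t] = \det (M t).
  rewrite -horner_evalE /p -det_map_mx /M mulmxDr mulmxDl -scalemxAr -scalemxAl.
  move: (U *m A *m V) (U *m B *m V) => A1 B1.
  congr (\det _); apply/matrixP => i j.
  by rewrite !mxE /= horner_evalE !hornerE.
exists p => [|t]; first by rewrite rootE pE M0 det1 oner_eq0.
rewrite rootE pE -unitfE -unitmxE => /mxrank_unit rM.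
rewrite -[X in (X <= _)%N]rM /M; apply: leq_trans (mxrankM_maxl _ _) _.
exact: mxrankM_maxr.
Qed.

(** * Coordinates and the matrix of the form *)

Lemma memv_mx2vs (K : fieldType) (vT : vectType K) m (M : 'M_(m, dim vT)) x :
  (x \in mx2vs M) = (v2r x <= M)%MS.
Proof. by rewrite [LHS]genmxE genmxE. Qed.

Lemma memv_vs2mx (K : fieldType) (vT : vectType K) (U : {vspace vT}) x :
  (x \in U) = (v2r x <= vs2mx U)%MS.
Proof. by rewrite -memv_mx2vs vs2mxK. Qed.

Lemma dimv_mx2vs (K : fieldType) (vT : vectType K) m (M : 'M_(m, dim vT)) :
  \dim (mx2vs M) = \rank M.
Proof. by rewrite /dimv genmxE. Qed.

(** The matrix of B_l is affine along a line of forms [l], so [mxrank_line] applies to it. *)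
Definition gram (K : fieldType) (g : lieAlgebraType K) (l : 'Hom(g, K^o)) :
    'M[K]_(dim g) :=
  \matrix_(i, j) l [lie r2v (delta_mx 0 i), r2v (delta_mx 0 j)].

HB.instance Definition _ (K : fieldType) (g : lieAlgebraType K) :=
  GRing.isLinear.Build K g 'End(g) *:%R (@ad K g) (@ad_linear K g).

Lemma gramE (K : fieldType) (g : lieAlgebraType K) (l : 'Hom(g, K^o)) x y :
  (v2r x *m gram l *m (v2r y)^T) 0 0 = l [lie x, y].
Proof.
rewrite -[in RHS](v2rK x) -[in RHS](v2rK y).
rewrite [in RHS](row_sum_delta (v2r x)) [in RHS](row_sum_delta (v2r y)).
set X := v2r x; set Y := v2r y.
rewrite -adE !linear_sum /= mxE.
apply: eq_bigr => j _; rewrite [X in X * _]mxE [X in _ * X]mxE.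
rewrite sum_lfunE linear_sum mulr_suml; apply: eq_bigr => i _.
rewrite !linearZ /= scale_lfunE !linearZ /= adE mxE.
by rewrite -mulrA [_ * Y _ _]mulrC.
Qed.

Lemma orth_mx2vs (K : fieldType) (g : lieAlgebraType K) (l : 'Hom(g, K^o))
    (V : {vspace g}) :
  orth l V = mx2vs (kermx (gram l *m (vs2mx V)^T)).
Proof.
apply/vspaceP => x; rewrite memv_mx2vs; apply/orthP/sub_kermxP => [xV | xV v].
  apply/rowP => i; rewrite mulmxA [RHS]mxE.
  have := xV (r2v (row i (vs2mx V))).
  rewrite memv_vs2mx r2vK row_sub -gramE r2vK.
  move=> /(_ isT) <-; rewrite [LHS]mxE [RHS]mxE.
  by apply: eq_bigr => j _; congr (_ * _); rewrite !mxE.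
rewrite memv_vs2mx -gramE => /submxP[w ->].
by rewrite trmx_mul mulmxA -[_ *m gram l *m _]mulmxA xV mul0mx mxE.
Qed.

Lemma dim_orth (K : fieldType) (g : lieAlgebraType K) (l : 'Hom(g, K^o))
    (V : {vspace g}) :
  \dim (orth l V) = (\dim {:g} - \rank (gram l *m (vs2mx V)^T))%N.
Proof. by rewrite orth_mx2vs dimv_mx2vs mxrank_ker dimvf. Qed.

Lemma lieC (K : fieldType) (g : lieAlgebraType K) (x y : g) :
  [lie x, y] = - [lie y, x].
Proof.
have := liexx (x + y); rewrite -!adE !linearD /= !add_lfunE !adE !liexx.
by rewrite add0r addr0 addrC => /eqP; rewrite addr_eq0 => /eqP.
Qed.

Lemma tr_gram (K : fieldType) (g : lieAlgebraType K) (l : 'Hom(g, K^o)) :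
  (gram l)^T = - gram l.
Proof. by apply/matrixP => i j; rewrite !mxE lieC linearN. Qed.

(** V^l is the annihilator of the image of V under B_l, and this image has dimension dim V - dim (V
    ∩ g^l). Skew-symmetry of [gram l] lets V act from either side. *)
Lemma dim_orthD (K : fieldType) (g : lieAlgebraType K) (l : 'Hom(g, K^o))
    (V : {vspace g}) :
  (\dim (orth l V) + \dim V = \dim {:g} + \dim (V :&: form_ker l))%N.
Proof.
rewrite dim_orth -mxrank_tr trmx_mul trmxK tr_gram mulmxN mxrank_opp.
have := mxrank_mul_ker (vs2mx V) (gram l).
have -> : \rank (vs2mx V :&: kermx (gram l)) = \dim (V :&: form_ker l).
  rewrite /form_ker orth_mx2vs -dimv_mx2vs; congr (\dim _).
  apply/vspaceP => x.
  rewrite memv_mx2vs sub_capmx memv_cap memv_mx2vs -memv_vs2mx.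
  congr (_ && _); rewrite !sub_kermx mulmxA.
  have -> : vs2mx {:g} = 1%:M by rewrite /= genmx1.
  by rewrite trmx1 mulmx1.
have := mxrankM_maxl (vs2mx V) (gram l); have := dimvS (subvf V).
rewrite -/(\dim V).
move: (\rank _) (\dim (_ :&: _)) (\dim V) (\dim _) => *; lia.
Qed.

(** * Generic points on a line of linear forms *)

Lemma generic_orth (K : closedFieldType) (g : lieAlgebraType K)
    (l1 l2 : 'Hom(g, K^o)) (V1 V2 : {vspace g}) :
  exists l : 'Hom(g, K^o), (\dim (orth l V1) <= \dim (orth l1 V1))%N /\
    (\dim (orth l V2) <= \dim (orth l2 V2))%N.
Proof.
have [p p0 pP] := mxrank_line (gram l1 *m (vs2mx V1)^T)
  ((gram l2 - gram l1) *m (vs2mx V1)^T).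
have [q q0 qP] := mxrank_line (gram l2 *m (vs2mx V2)^T)
  ((gram l1 - gram l2) *m (vs2mx V2)^T).
(* Seen from [l2] the parameter is 1 - t, hence the substitution in [q]; its value at 1 is q(0),
   which is nonzero. *)
have pq0 : p * (q \Po (1 - 'X)) != 0.
  apply: contraNneq p0 => /eqP; rewrite mulf_eq0 => /orP[/eqP ->|/eqP q0'].
    exact: root0.
  case/negP: q0; rewrite rootE; apply/eqP.
  have : (q \Po (1 - 'X)).[1] = 0 by rewrite q0' horner0.
  by rewrite horner_comp !hornerE subrr.
have [t] := (closed_nonrootP _ pq0).
rewrite rootM negb_or root_comp !hornerE => /andP[pt qt].
have gramt : gram (l1 + t *: (l2 - l1)) = gram l1 + t *: (gram l2 - gram l1).
  by apply/matrixP => i j; rewrite !(mxE, add_lfunE, scale_lfunE, opp_lfunE).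
exists (l1 + t *: (l2 - l1)); rewrite !dim_orth; split; apply: leq_sub2l.
  by rewrite gramt mulmxDl -scalemxAl; apply: pP.
have -> : gram (l1 + t *: (l2 - l1)) = gram l2 + (1 - t) *: (gram l1 - gram l2).
  rewrite gramt scalerBl scale1r [RHS]addrA (addrC (gram l2) (_ - _)) subrK.
  by rewrite -scalerN opprB.
by rewrite mulmxDl -scalemxAl; apply: qP.
Qed.

(** * The action of g on the dual of a *)

Lemma restr_surj (K : fieldType) (g : lieAlgebraType K) (a : {vspace g})
    (f : 'Hom(subvs_of a, K^o)) :
  exists l : 'Hom(g, K^o), restr a l = f.
Proof.
exists (f \o linfun (vsproj a))%VF; apply/lfunP => x.
by rewrite restrE comp_lfunE lfunE /= vsvalK.
Qed.

Lemma lker_coact (K : fieldType) (g : lieAlgebraType K) (a : {vspace g})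
    (a_ideal : is_ideal a) (l : 'Hom(g, K^o)) :
  lker (linfun (coact (restr a l))) = orth l a.
Proof.
apply/vspaceP => x; rewrite memv_ker lfunE /=.
apply/eqP/orthP => [+ v av | lx].
  move/lfunP/(_ (Subvs av)); rewrite zero_lfunE.
  rewrite (@coactE _ _ _ _ _ (Subvs av) (a_ideal x v av)) restrE.
  by move=> /eqP; rewrite oppr_eq0 => /eqP.
apply/lfunP => v; rewrite (coactE _ (a_ideal x _ (subvsP v))) restrE zero_lfunE.
by rewrite lx ?oppr0 ?subvsP.
Qed.

(** Rank-nullity for x |-> x.l_0, whose kernel is a^l. *)
Lemma coorbit_codimD (K : fieldType) (g : lieAlgebraType K) (a : {vspace g})
    (a_ideal : is_ideal a) (l : 'Hom(g, K^o)) :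
  (coorbit_codim (restr a l) + \dim {:g} = \dim a + \dim (orth l a))%N.
Proof.
have := limg_ker_dim (linfun (coact (restr a l))) {:g}.
rewrite capfv lker_coact // -/(coorbit _).
have := dimvS (subvf (coorbit (restr a l))); rewrite /coorbit_codim.
have -> : \dim {: 'Hom(subvs_of a, K^o)} = \dim a.
  by rewrite dimvf /dim /= muln1.
by move=> ca <-; rewrite addnCA subnK // addnC.
Qed.

Lemma rel_ind_le (K : fieldType) (g : lieAlgebraType K) (a : {vspace g})
    (a_ideal : is_ideal a) (l : 'Hom(g, K^o)) :
  (rel_ind a + \dim {:g} <= \dim a + \dim (orth l a))%N.
Proof.
rewrite -coorbit_codimD // leq_add2r.
by case: (min_valueP 0 (@coorbit_codim K g a)).
Qed.

(** With [rel_ind_le], this turns membership in Omega into minimality of dim a^l. *)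
Lemma OmegaE (K : fieldType) (g : lieAlgebraType K) (a : {vspace g})
    (a_ideal : is_ideal a) (l : 'Hom(g, K^o)) :
  Omega a l <-> (rel_ind a + \dim {:g} = \dim a + \dim (orth l a))%N.
Proof.
by rewrite -coorbit_codimD // /Omega; split=> [-> // | /addIn].
Qed.

Lemma exists_Omega (K : fieldType) (g : lieAlgebraType K) (a : {vspace g}) :
  exists l : 'Hom(g, K^o), Omega a l.
Proof.
have [[f fP] _] := min_valueP 0 (@coorbit_codim K g a).
by have [l lf] := restr_surj f; exists l; rewrite /Omega lf.
Qed.

Lemma ind_le (K : fieldType) (g : lieAlgebraType K) (l : 'Hom(g, K^o)) :
  (ind g <= \dim (form_ker l))%N.
Proof. by case: (min_valueP 0 (fun l : 'Hom(g, K^o) => \dim (form_ker l))). Qed.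

Lemma exists_regular_Omega (K : closedFieldType) (g : lieAlgebraType K)
    (a : {vspace g}) (a_ideal : is_ideal a) :
  exists2 l : 'Hom(g, K^o), Omega a l & \dim (form_ker l) = ind g.
Proof.
have [l1 /(OmegaE a_ideal) l1P] := exists_Omega a.
have [[l2 l2P] _] := min_valueP 0 (fun l : 'Hom(g, K^o) => \dim (form_ker l)).
(* Both dimensions are already minimal at [l1] and [l2] respectively, so the two inequalities are
   equalities. *)
have [l [la lg]] := generic_orth l1 l2 a fullv; exists l.
  by apply/(OmegaE a_ideal)/eqP; rewrite eqn_leq rel_ind_le // l1P leq_add2l.
by apply/eqP; rewrite eqn_leq ind_le andbT /ind -l2P.
Qed.

(** * Orthogonals and biorthogonals *)

Lemma orth_subalgebra (K : fieldType) (g : lieAlgebraType K) (a : {vspace g})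
    (a_ideal : is_ideal a) (l : 'Hom(g, K^o)) :
  is_subalgebra (orth l a).
Proof.
move=> x y /orthP lx /orthP ly; apply/orthP => v av.
have -> : [lie [lie x, y], v] = [lie x, [lie y, v]] + [lie y, [lie v, x]].
  by rewrite lieC; apply/esym/eqP; rewrite -addr_eq0 lie_jacobi.
rewrite linearD /= lx ?a_ideal // ly ?addr0 // lieC -scaleN1r rpredZ //.
exact: a_ideal.
Qed.

Lemma form_ker_sub_orth (K : fieldType) (g : lieAlgebraType K)
    (l : 'Hom(g, K^o)) (V : {vspace g}) :
  (form_ker l <= orth l V)%VS.
Proof.
by apply/subvP => x /orthP lx; apply/orthP => v _; rewrite lx ?memvf.
Qed.

Lemma sub_orth_orth (K : fieldType) (g : lieAlgebraType K) (l : 'Hom(g, K^o))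
    (V : {vspace g}) :
  (V + form_ker l <= orth l (orth l V))%VS.
Proof.
rewrite subv_add form_ker_sub_orth andbT; apply/subvP => x Vx.
by apply/orthP => v /orthP lv; rewrite lieC linearN /= lv ?oppr0.
Qed.

(** One inclusion is skew-symmetry; the dimensions agree by [dim_orthD] applied to V and to V^l,
    which contains g^l. *)
Lemma orth_orth (K : fieldType) (g : lieAlgebraType K) (l : 'Hom(g, K^o))
    (V : {vspace g}) :
  orth l (orth l V) = (V + form_ker l)%VS.
Proof.
apply/esym/eqP; rewrite eqEdim sub_orth_orth /=.
have /capv_idPr ker_cap := form_ker_sub_orth l V.
have := dimv_sum_cap V (form_ker l); have := dim_orthD l V.
have := dim_orthD l (orth l V); rewrite ker_cap.
move: (\dim {:g}) (\dim (form_ker l)) (\dim V).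
move: (\dim (orth _ V)) (\dim (orth _ _)) (\dim (_ :&: _)) (\dim (_ + _)) => *; lia.
Qed.

Lemma orth_addl_ker (K : fieldType) (g : lieAlgebraType K) (l : 'Hom(g, K^o))
    (V : {vspace g}) :
  orth l (V + form_ker l) = orth l V.
Proof.
apply/subv_anti/andP; split; apply/subvP => x /orthP lx.
  by apply/orthP => v Vv; apply: lx; rewrite (subvP (addvSl _ _)).
apply/orthP => _ /memv_addP[v Vv [k /orthP lk ->]].
by rewrite linearD /= linearD /= lx // lieC linearN /= lk ?memvf // oppr0 addr0.
Qed.

Lemma add_ker_sub_orth (K : fieldType) (g : lieAlgebraType K)
    (a : {vspace g}) (a_abelian : is_abelian a) (l : 'Hom(g, K^o)) :
  (a + form_ker l <= orth l a)%VS.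
Proof.
rewrite subv_add form_ker_sub_orth andbT; apply/subvP => x ax.
by apply/orthP => v av; rewrite a_abelian ?linear0.
Qed.

Lemma dim_add_ker (K : fieldType) (g : lieAlgebraType K)
    (V : {vspace g}) (l : 'Hom(g, K^o)) :
  (\dim (V + form_ker l) + \dim (orth l V) = \dim {:g} + \dim (form_ker l))%N.
Proof.
have := dimv_sum_cap V (form_ker l); have := dim_orthD l V.
move: (\dim {:g}) (\dim (form_ker l)) (\dim V) (\dim (orth _ _)).
move: (\dim (_ :&: _)) (\dim (_ + _)) => *; lia.
Qed.

(** The inclusion of a + g^l in a^l bounds dim g + dim g^l by 2 dim a^l, and on Omega dim a^l =
    ind(g, a) + dim g - dim a. *)
Lemma Omega_dim_form_ker (K : fieldType) (g : lieAlgebraType K)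
    (a : {vspace g}) (a_ideal : is_ideal a) (a_abelian : is_abelian a)
    (l : 'Hom(g, K^o)) (al : Omega a l) :
  (\dim (form_ker l) + \dim a <= (\dim {:g} - \dim a) + 2 * rel_ind a
     ?= iff ((a + form_ker l)%VS == orth l a))%N.
Proof.
have /(OmegaE a_ideal) := al; have := dim_add_ker a l.
have := dimv_leqif_eq (add_ker_sub_orth a_abelian l); have := dimvS (subvf a).
set b := _ == _; rewrite /leqif; move: b.
move: (\dim (_ + _)) (\dim (orth _ a)) (\dim a) (\dim (form_ker l)).
move: (\dim {:g}) (rel_ind a) => n r s o d k b.
by move=> dn [so <-] H1 H2; split; [lia | apply/eqP/eqP; lia].
Qed.

Theorem mainTheorem2 (R : realType) (g : lieAlgebraType R[i])
    (a : {vspace g}) (a_ideal : is_ideal a) (a_abelian : is_abelian a) :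
  [<-> (ind g + \dim a = (\dim {:g} - \dim a) + 2 * rel_ind a)%N ;
       forall l : 'Hom(g, R[i]^o), Omega a l ->
         (a + form_ker l)%VS = orth l a ;
       forall l : 'Hom(g, R[i]^o), Omega a l ->
         is_polarization l (a + form_ker l)%VS ;
       forall l : 'Hom(g, R[i]^o), Omega a l ->
         is_polarization l (orth l a) ].
Proof.
tfae.
- move=> indE l al; apply/eqP.
  have kP := Omega_dim_form_ker a_ideal a_abelian al.
  by rewrite -(geq_leqif kP) -indE leq_add2r ind_le.
- move=> aE l /aE aEl; rewrite /is_polarization orth_addl_ker aEl.
  by split=> //; apply: orth_subalgebra.
(* The orthogonal of a + g^l is a^l, so being a polarization forces a + g^l = a^l. *)
- move=> aP l /aP[_]; rewrite orth_addl_ker => aEl; split.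
    exact: orth_subalgebra.
  by rewrite orth_orth -aEl.
(* One [l] in Omega with dim g^l = ind g suffices: there (4) gives the equality case of the
   bound. *)
have [l al <-] := exists_regular_Omega a_ideal.
move=> /(_ l al)[_]; rewrite orth_orth => aEl.
by apply/eqP; rewrite (Omega_dim_form_ker a_ideal a_abelian al) aEl.
Qed.
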